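(* Let $\varphi:G_1\to G_2$ be a surjective group homomorphism and let $H_1$ be an almost normal subgroup of $G_1$ containing $\ker\varphi$. If the Hecke pair $(G_1,H_1)$ has (RD), then $(G_2,\varphi(H_1))$ is a Hecke pair with property (RD).
   Context: All groups are discrete. A subgroup $H\leq G$ is almost normal if every double coset $HgH$ ($g\in G$) is a union of finitely many left cosets of $H$; then $(G,H)$ is called a Hecke pair. A length function on $G$ is a map $L:G\to[0,\infty)$ with $L(1)=0$, $L(g^{-1})=L(g)$ and $L(gh)\leq L(g)+L(h)$ for all $g,h\in G$; put $N_L=\{g\in G: L(g)=0\}$. A length function on a Hecke pair $(G,H)$ is a length function $L$ on $G$ with $H\subseteq N_L$ (so $L$ is constant on double cosets of $H$). $\mathcal{H}(G,H)$ is the space of finitely supported complex functions on the set of double cosets $G//H$, regarded as $H$-bi-invariant functions on $G$; elements of $\ell^2(H\backslash G)$ are regarded as left $H$-invariant functions on $G$. The regular representation $\lambda:\mathcal{H}(G,H)\to\mathcal{B}(\ell^2(H\backslash G))$ is $\lambda(f)(\xi)(g)=\sum_{h\in H\backslash G} f(gh^{-1})\xi(h)$ (sum over representatives of right cosets). For $s\geq 0$, $\|f\|_{s,L}=\big(\sum_{g\in H\backslash G}|f(g)|^2(1+L(g))^{2s}\big)^{1/2}$. The Hecke pair $(G,H)$ has property (RD) with respect to a length function $L$ on $(G,H)$ if there are $C,s>0$ with $\|\lambda(f)\|\leq C\|f\|_{s,L}$ for all $f\in\mathcal{H}(G,H)$. It has (RD) if it has (RD) with respect to some length function on $(G,H)$.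 *)

(* Defs.v *)
From HB Require Import structures.
From mathcomp Require Import all_boot all_order all_algebra.
From mathcomp Require Import complex.
From mathcomp Require Import all_classical all_reals all_analysis.

Set Implicit Arguments.
Unset Strict Implicit.
Unset Printing Implicit Defensive.

Import Order.TTheory GRing.Theory Num.Theory.
Import numFieldNormedType.Exports.

Local Open Scope classical_set_scope.
Local Open Scope ring_scope.

Section HeckePair.
Context {G : groupType}.
Implicit Types (H : set G) (g : G).

Definition subgroup H := group_closed (mem H).

Definition left_coset H g : set G := [set (g * h)%g | h in H].

Definition right_coset H g : set G := [set (h * g)%g | h in H].

Definition double_coset H g : set G :=
  [set (h * g * k)%g | h in H & k in H].

Definition right_cosets H : set (set G) := range (right_coset H).

Definition double_cosets H : set (set G) := range (double_coset H).

(* An arbitrary element of the nonempty subset C (1 if C is empty); sums over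
   cosets below are sums over these representatives. *)
Definition coset_repr (C : set G) : G := xget 1%g C.

Definition almost_normal H := forall g, exists2 A : set G,
  finite_set A & double_coset H g = \bigcup_(x in A) left_coset H x.

Definition Hecke_pair H := subgroup H /\ almost_normal H.

End HeckePair.

Section LengthFunction.
Context {R : realType} {G : groupType}.
Implicit Types (L : G -> R) (H : set G).

Definition length_function L :=
  [/\ forall g, 0 <= L g,
      L 1%g = 0,
      forall g, L g^-1%g = L g &
      forall g h, L (g * h)%g <= L g + L h].

Definition length_kernel L : set G := [set g | L g = 0].

Definition length_function_on H L := length_function L /\ H `<=` length_kernel L.

End LengthFunction.

Section RapidDecay.
Context {R : realType} {G : groupType}.
Implicit Types (H : set G) (f xi : G -> R[i]) (L : G -> R) (s : R).

Definition bi_invariant H f :=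
  forall h k g, H h -> H k -> f (h * g * k)%g = f g.

Definition Hecke_algebra H f := bi_invariant H f /\
  finite_set [set D | double_cosets H D /\ f (coset_repr D) != 0].

Definition left_invariant H xi := forall h g, H h -> xi (h * g)%g = xi g.

Definition l2norm H xi : \bar R :=
  sqrte (\esum_(C in right_cosets H) (Normc.normc (xi (coset_repr C)) ^+ 2)%:E).

Definition l2 H xi := left_invariant H xi /\ (l2norm H xi < +oo)%E.

(* For f in the Hecke algebra of a Hecke pair and xi left H-invariant, the
   summand depends only on the right coset of h and vanishes outside finitely
   many right cosets, so the finitely supported sum is the full sum. *)
Definition regular_rep H f xi : G -> R[i] := fun g =>
  \sum_(C \in right_cosets H) f (g * (coset_repr C)^-1)%g * xi (coset_repr C).

Definition opnorm H (T : (G -> R[i]) -> (G -> R[i])) : \bar R :=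
  ereal_sup [set l2norm H (T xi) | xi in
               [set xi | l2 H xi /\ (l2norm H xi <= 1)%E]].

Definition weighted_norm H L s f : \bar R :=
  sqrte (\esum_(C in right_cosets H)
    (Normc.normc (f (coset_repr C)) ^+ 2 *
     (1 + L (coset_repr C)) `^ (2 * s))%:E).

Definition RD_wrt H L := exists C s : R, [/\ 0 < C, 0 < s &
  forall f, Hecke_algebra H f ->
    (opnorm H (regular_rep H f) <= C%:E * weighted_norm H L s f)%E].

End RapidDecay.

(* R is explicit: it is the field of reals in which lengths and norms live. *)
Definition has_RD (R : realType) {G : groupType} (H : set G) :=
  exists L : G -> R, length_function_on H L /\ RD_wrt H L.

(* Main.v *)
(** Since [H1] contains the kernel, taking images under [phi] is a bijection
    from the right (and double) cosets of [H1] to those of [phi(H1)], and a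
    length function vanishing on [H1] descends along [phi].  Pulling functions
    back along [phi] then preserves the Hecke algebra, the weighted norms and
    the l2 norms, and intertwines the two regular representations, so the
    operator norm of [f] is at most that of its pullback. *)
Require Import Defs.
From HB Require Import structures.
From mathcomp Require Import all_boot all_order all_algebra.
From mathcomp Require Import complex.
From mathcomp Require Import all_classical all_reals all_analysis.

Import Order.TTheory GRing.Theory Num.Theory.

Local Open Scope classical_set_scope.

Section Subgroups.
Context {G : groupType}.
Implicit Types (H : set G) (g h : G).

Lemma subgroup1 {H} : subgroup H -> H 1%g.
Proof. by case; rewrite inE. Qed.

Lemma subgroupF {H g h} : subgroup H -> H g -> H h -> H (g / h)%g.
Proof. by case=> _ HF Hg Hh; apply/set_mem/HF; apply/mem_set. Qed.

Lemma subgroupV {H g} : subgroup H -> H g -> H g^-1%g.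
Proof.
by move=> sH Hg; rewrite -div1g; apply: subgroupF => //; apply: subgroup1.
Qed.

Lemma subgroupM {H g h} : subgroup H -> H g -> H h -> H (g * h)%g.
Proof. by move=> sH Hg Hh; rewrite -[h]invgK; apply/subgroupF/subgroupV. Qed.

(** [H 1%g] makes the coset nonempty, so the default value of [coset_repr] never occurs. The choice
    being arbitrary, the factor in [H] is all that is known about it. *)
Lemma coset_repr_right_coset {H} (g : G) : H 1%g ->
  exists2 h, H h & coset_repr (right_coset H g) = (h * g)%g.
Proof.
move=> H1; have [] : right_coset H g (coset_repr (right_coset H g)).
  by apply: xgetPex; exists (1 * g)%g; exists 1%g.
by move=> h Hh <-; exists h.
Qed.

Lemma coset_repr_double_coset {H} (g : G) : H 1%g ->
  exists h k, [/\ H h, H k & coset_repr (double_coset H g) = (h * g * k)%g].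
Proof.
move=> H1; have [] : double_coset H g (coset_repr (double_coset H g)).
  by apply: xgetPex; exists (1 * g * 1)%g; exists 1%g => //; exists 1%g.
by move=> h Hh [k Hk <-]; exists h, k.
Qed.

End Subgroups.

Lemma length_function_kernelM {R : realType} {G : groupType} (L : G -> R)
    (g k : G) :
  length_function L -> L k = 0%R -> L (g * k)%g = L g.
Proof.
case=> _ _ LV LM Lk; apply/le_anti/andP; split.
  by rewrite (le_trans (LM _ _))// Lk addr0.
(* The reverse bound is the triangle inequality for [g = (g * k) * k^-1]. *)
by rewrite -{1}[g](mulgK k) (le_trans (LM _ _))// LV Lk addr0.
Qed.

Lemma length_function_Mkernel {R : realType} {G : groupType} (L : G -> R)
    (k g : G) :
  length_function L -> L k = 0%R -> L (k * g)%g = L g.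
Proof.
move=> LL Lk; have [_ _ LV _] := LL.
by rewrite -LV invgM length_function_kernelM ?LV.
Qed.

Section GroupMultiplicative.
Context {G1 G2 : groupType} (phi : {multiplicative G1 -> G2}).

Lemma multiplicative1 : phi 1%g = 1%g.
Proof. by apply: (mulIg (phi 1%g)); rewrite -gmulfM !mul1g. Qed.

Lemma multiplicativeV : {morph phi : x / x^-1%g}.
Proof.
by move=> x; apply: (mulIg (phi x)); rewrite -gmulfM !mulVg multiplicative1.
Qed.

Lemma multiplicativeF : {morph phi : x y / (x / y)%g}.
Proof. by move=> x y; rewrite gmulfM multiplicativeV. Qed.

End GroupMultiplicative.

(** * Images of subgroups and cosets under [phi] *)

Section Pushforward.
Context {G1 G2 : groupType} {phi : {multiplicative G1 -> G2}} {H1 : set G1}.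
Local Notation H2 := (phi @` H1).

Lemma image_left_coset (g : G1) :
  phi @` left_coset H1 g = left_coset H2 (phi g).
Proof.
by rewrite /left_coset !image_comp; apply: eq_imagel => h _ /=; rewrite gmulfM.
Qed.

Lemma image_right_coset (g : G1) :
  phi @` right_coset H1 g = right_coset H2 (phi g).
Proof.
by rewrite /right_coset !image_comp; apply: eq_imagel => h _ /=; rewrite gmulfM.
Qed.

Lemma image_double_coset (g : G1) :
  phi @` double_coset H1 g = double_coset H2 (phi g).
Proof.
apply/seteqP; split.
  move=> _ [_ [h Hh [k Hk <-]] <-]; exists (phi h); first by exists h.
  by exists (phi k); [exists k|rewrite !gmulfM].
move=> _ [_ [h Hh <-] [_ [k Hk <-] <-]].
by exists (h * g * k)%g; [exists h => //; exists k|rewrite !gmulfM].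
Qed.

Hypotheses (phi_surj : set_surj [set: G1] [set: G2] phi) (sH : subgroup H1).

Lemma subgroup_image : subgroup H2.
Proof.
split; first by rewrite inE; exists 1%g; [exact: subgroup1|exact: multiplicative1].
move=> x y; rewrite !inE => -[g Hg <-] [h Hh <-].
by exists (g / h)%g; [exact: subgroupF|rewrite multiplicativeF].
Qed.

Lemma almost_normal_image : almost_normal H1 -> almost_normal H2.
Proof.
move=> aH y; have [g _ <-] := phi_surj y I.
have [A finA HA] := aH g; exists (phi @` A); first exact: finite_image.
rewrite -image_double_coset HA image_bigcup bigcup_image.
by apply: eq_bigcupr => x _; rewrite image_left_coset.
Qed.

Lemma apply_repr_image {T : Type} (u : G2 -> T) (C : set G1) :
  (forall h g, H2 h -> u (h * g)%g = u g) -> right_cosets H1 C ->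
  u (coset_repr (phi @` C)) = u (phi (coset_repr C)).
Proof.
move=> uH [g _ <-]; rewrite image_right_coset.
have [h Hh ->] := coset_repr_right_coset g (subgroup1 sH).
have [k Hk ->] := coset_repr_right_coset (phi g) (subgroup1 subgroup_image).
by rewrite gmulfM !uH//; exists h.
Qed.

Hypothesis kerH : phi @^-1` [set 1%g] `<=` H1.

(** The form in which the kernel hypothesis enters all later arguments. *)
Lemma phi_eqP {g h : G1} : phi g = phi h -> exists2 k, H1 k & g = (k * h)%g.
Proof.
move=> gh; exists (g / h)%g; last by rewrite divgK.
by apply: kerH => /=; rewrite multiplicativeF gh divgg.
Qed.

(** Two points with the same image differ by a left factor in [H1], which the coset absorbs.
    Recovering [C] from its image gives the injectivity in [right_cosets_bij]. *)
Lemma preimage_image_right_coset (C : set G1) : right_cosets H1 C ->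
  phi @^-1` (phi @` C) = C.
Proof.
move=> [g _ <-]; apply/seteqP; split=> [x|]; last exact: preimage_image.
case=> _ [h Hh <-] /esym/phi_eqP[k Hk ->].
by exists (k * h)%g; [exact: subgroupM|rewrite mulgA].
Qed.

Lemma preimage_image_double_coset (C : set G1) : double_cosets H1 C ->
  phi @^-1` (phi @` C) = C.
Proof.
move=> [g _ <-]; apply/seteqP; split=> [x|]; last exact: preimage_image.
case=> _ [h Hh [l Hl <-]] /esym/phi_eqP[k Hk ->].
by exists (k * h)%g; [exact: subgroupM|exists l => //; rewrite !mulgA].
Qed.

Lemma right_cosets_bij :
  set_bij (right_cosets H1) (right_cosets H2) (fun C => phi @` C).
Proof.
split.
- by move=> _ [g _ <-]; exists (phi g); rewrite ?image_right_coset.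
- move=> C D; rewrite !inE => HC HD CD.
  by rewrite -(preimage_image_right_coset _ HC) CD preimage_image_right_coset.
- move=> _ [y _ <-]; have [g _ <-] := phi_surj y I.
  by exists (right_coset H1 g); [exists g|rewrite image_right_coset].
Qed.

(** * Pulling functions, norms and operators back along [phi] *)

Section Functions.
Context {R : realType}.
Local Open Scope ring_scope.
Implicit Types (f xi : G2 -> R[i]) (L : G1 -> R).

Lemma esum_right_cosets_image (u : G2 -> \bar R) :
  (forall h g, H2 h -> u (h * g)%g = u g) ->
  (\esum_(D in right_cosets H2) u (coset_repr D) =
   \esum_(C in right_cosets H1) u (phi (coset_repr C)))%E.
Proof.
move=> uH; rewrite (reindex_esum _ _ _ _ right_cosets_bij).
by apply: eq_esum => C HC; exact: apply_repr_image.
Qed.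

Lemma l2norm_comp xi : left_invariant H2 xi ->
  l2norm H1 (xi \o phi) = l2norm H2 xi.
Proof.
move=> xiH; congr sqrte; rewrite [RHS](esum_right_cosets_image
  (fun g => (Normc.normc (xi g) ^+ 2)%:E))//.
by move=> h g Hh; rewrite xiH.
Qed.

Lemma left_invariant_comp xi : left_invariant H2 xi ->
  left_invariant H1 (xi \o phi).
Proof. by move=> xiH h g Hh /=; rewrite gmulfM xiH//; exists h. Qed.

Lemma Hecke_algebra_comp f : Hecke_algebra H2 f -> Hecke_algebra H1 (f \o phi).
Proof.
move=> [fH finf]; split=> [h k g Hh Hk/=|].
  by rewrite !gmulfM fH; [|exists h|exists k].
(* Each double coset in the support of the pullback is the preimage of its own image, which lies in
   the finite support of [f]. *)
apply: (sub_finite_set _ (finite_image (fun D => phi @^-1` D) finf)) => D.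
move=> [HD fD]; exists (phi @` D); last exact: preimage_image_double_coset.
move: HD fD => [g _ <-]; rewrite image_double_coset => fD; split.
  by exists (phi g).
(* By bi-invariance, [f] takes the value [f (phi g)] both at the representative downstairs and at
   the image of the one upstairs. *)
have [h [k [Hh Hk]]] := coset_repr_double_coset (phi g) (subgroup1 subgroup_image).
move=> ->; rewrite fH//; move: fD => /=.
have [h' [k' [Hh' Hk' ->]]] := coset_repr_double_coset g (subgroup1 sH).
by rewrite !gmulfM fH; [|exists h'|exists k'].
Qed.

(** Allows [l2norm_comp] to be applied to the image of [xi] under the operator. *)
Lemma left_invariant_regular_rep f xi : bi_invariant H2 f ->
  left_invariant H2 (regular_rep H2 f xi).
Proof.
move=> fH h g Hh; rewrite /regular_rep; apply: eq_fsbigr => D _.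
have := fH h 1%g (g * (coset_repr D)^-1)%g Hh (subgroup1 subgroup_image).
by rewrite mulg1 mulgA => ->.
Qed.

Lemma regular_rep_comp f xi : bi_invariant H2 f -> left_invariant H2 xi ->
  regular_rep H1 (f \o phi) (xi \o phi) = regular_rep H2 f xi \o phi.
Proof.
move=> fH xiH; apply/funext => g; rewrite /regular_rep /=.
rewrite [RHS](reindex_fsbig _ _ _ _ right_cosets_bij).
apply: eq_fsbigr => C; rewrite inE => HC.
rewrite gmulfM multiplicativeV.
(* The summand is constant on right cosets: a left factor in [H2] is absorbed by [xi], and its
   inverse by the right invariance of [f]. *)
rewrite (apply_repr_image (fun h => f (phi g * h^-1)%g * xi h))// => h k Hh.
rewrite xiH// invgM mulgA.
have := fH 1%g h^-1%g (phi g * k^-1)%g (subgroup1 subgroup_image)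
  (subgroupV subgroup_image Hh).
by rewrite mul1g => ->.
Qed.

(** Pullback embeds the unit ball over [H2] isometrically into the one over [H1], so the supremum
    upstairs runs over at least as many vectors. *)
Lemma le_opnorm_comp f : bi_invariant H2 f ->
  (opnorm H2 (regular_rep H2 f) <= opnorm H1 (regular_rep H1 (f \o phi)))%E.
Proof.
move=> fH; apply: ge_ereal_sup => _ [xi [[xiH xioo] xi1] <-].
apply: ereal_sup_ubound; exists (xi \o phi).
  rewrite /l2 /= l2norm_comp//.
  by split=> //; split=> //; exact: left_invariant_comp.
by rewrite regular_rep_comp// l2norm_comp//; exact: left_invariant_regular_rep.
Qed.

Lemma descend_length_function L : length_function_on H1 L ->
  exists2 L2 : G2 -> R, length_function_on H2 L2 & L2 \o phi = L.
Proof.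
move=> [LL HL]; have [L0 L1 LV LM] := LL.
(* Here [s] is a set-theoretic section of [phi]. Although it need not be multiplicative, [s (phi x)]
   and [x] differ by an element of [H1], where [L] vanishes; so [L \o s] inherits every axiom from
   [L]. *)
have /choice[s sK] : forall y, exists x, phi x = y.
  by move=> y; have [x _] := phi_surj y I; exists x.
have Ls x : L (s (phi x)) = L x.
  have [k Hk ->] := phi_eqP (sK (phi x)).
  by apply: length_function_Mkernel => //; exact: HL.
exists (L \o s); last exact/funext.
split; last by move=> _ [h Hh <-] /=; rewrite /length_kernel /= Ls; exact: HL.
split=> [y|||y z] /=; first exact: L0.
- by rewrite -(multiplicative1 phi) Ls.
- by move=> y; rewrite -{1}[y]sK -multiplicativeV Ls LV.
- by rewrite -{1}[y]sK -{1}[z]sK -gmulfM Ls.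
Qed.

Lemma weighted_norm_comp (L : G2 -> R) s f :
  length_function_on H2 L -> bi_invariant H2 f ->
  weighted_norm H1 (L \o phi) s (f \o phi) = weighted_norm H2 L s f.
Proof.
move=> [LL HL] fH; congr sqrte; rewrite [RHS](esum_right_cosets_image
  (fun g => (Normc.normc (f g) ^+ 2 * (1 + L g) `^ (2 * s))%:E))// => h g Hh.
rewrite length_function_Mkernel//; last exact: HL.
have := fH h 1%g g Hh (subgroup1 subgroup_image).
by rewrite mulg1 => ->.
Qed.

Lemma has_RD_image : has_RD R H1 -> has_RD R H2.
Proof.
(* Once [L] is replaced by [L2 \o phi], the constants [C] and [s] serve unchanged for [H2]. *)
move=> [L [/descend_length_function[L2 LL2 <-] [C [s [C0 s0 RD]]]]].
exists L2; split=> //; exists C, s; split=> // f Hf; have [fH _] := Hf.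
apply: (le_trans (le_opnorm_comp _ fH)).
by rewrite -weighted_norm_comp//; exact/RD/Hecke_algebra_comp.
Qed.

End Functions.
End Pushforward.

Theorem proposition2p15 (R : realType) (G1 G2 : groupType)
    (phi : {multiplicative G1 -> G2}) (H1 : set G1) :
  set_surj [set: G1] [set: G2] phi ->
  subgroup H1 -> almost_normal H1 ->
  phi @^-1` [set 1%g] `<=` H1 ->
  has_RD R H1 ->
  Hecke_pair (phi @` H1) /\ has_RD R (phi @` H1).
Proof.
move=> phi_surj sH aH kerH RD; split; last exact: has_RD_image.
by split; [exact: subgroup_image|exact: almost_normal_image].
Qed.
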